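(* Let $(\mathcal{L},\circ_\lambda,[\cdot_\lambda\cdot])$ be a transposed Poisson conformal algebra. Then the following identities hold for all $x,y,z,h,u,v\in\mathcal{L}$ (with $\lambda,\mu,\gamma$ formal variables): \begin{align*} &(1)\quad x\circ_{\lambda}[y_{\mu}z]+y\circ_{\mu}[z_{-\partial-\lambda}x]+z\circ_{-\partial-\lambda-\mu}[x_{\lambda}y]=0,\\ &(2)\quad [x_{\lambda}y]\circ_{\mu}z+[y_{\mu-\lambda}z]\circ_{-\partial-\lambda}x+[z_{-\partial-\lambda}x]\circ_{-\partial-\mu+\lambda}y=0,\\ &(3)\quad [(h\circ_{\lambda}[x_{\gamma}y])_{\lambda+\mu}z]+[(h\circ_{\lambda}[y_{\mu-\gamma}z])_{-\partial-\gamma}x]+[(h\circ_{\lambda}[z_{-\partial-\gamma}x])_{-\partial-\mu+\gamma}y]=0,\\ &(4)\quad [[x_{\gamma}y]_{\mu}(h\circ_{\lambda}z)]+[[y_{\mu-\gamma}z]_{-\partial-\lambda-\gamma}(h\circ_{\lambda}x)]+[[z_{-\partial-\gamma}x]_{-\partial-\lambda-\mu+\gamma}(h\circ_{\lambda}y)]=0,\\ &(5)\quad [h_{\lambda}x]\circ_{\lambda+\gamma}[y_{\mu-\gamma}z]+[h_{\lambda}y]\circ_{\lambda+\mu-\gamma}[z_{-\partial-\gamma}x]+[h_{\lambda}z]\circ_{-\partial-\mu}[x_{\gamma}y]=0,\\ &(6)\quad [(u\circ_{\lambda}x)_{\mu}(v\circ_{\gamma}y)]+[(v\circ_{\gamma}x)_{\gamma+\mu-\lambda}(u\circ_{\lambda}y)]=2\,(u\circ_{\lambda}v)\circ_{\lambda+\gamma}[x_{\mu-\lambda}y],\\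 &(7)\quad x\circ_{\mu-\lambda}[u_{\lambda}(v\circ_{\gamma}y)]+[(v\circ_{\gamma}x)_{\gamma+\mu-\lambda}u]\circ_{\gamma+\mu}y=(u\circ_{\lambda}v)\circ_{\lambda+\gamma}[x_{\mu-\lambda}y]. \end{align*}
   Context: All vector spaces, linear maps and tensor products are over $\mathbb{C}$. For a vector space $A$, $A[\lambda]$ denotes polynomials in $\lambda$ with coefficients in $A$. A conformal algebra $(A,\circ_\lambda)$ is a $\mathbb{C}[\partial]$-module $A$ with a $\mathbb{C}$-bilinear map $A\otimes A\to A[\lambda]$, $a\otimes b\mapsto a\circ_\lambda b$, such that $(\partial a)\circ_\lambda b=-\lambda\, a\circ_\lambda b$ and $a\circ_\lambda(\partial b)=(\partial+\lambda)(a\circ_\lambda b)$. Convention: products are extended linearly to polynomials in formal variables. If $a\circ_\lambda b=\sum_n\lambda^n w_n$ and $\nu$ is a linear combination of formal variables, then $a\circ_{\nu}b=\sum_n \nu^n w_n$ and $a\circ_{-\partial+\nu}b=\sum_n(-\partial+\nu)^n w_n$, where $\partial$ acts on the coefficients $w_n$ of the product carrying that subscript. The same convention applies to $[a_\lambda b]$. A commutative associative conformal algebra is a conformal algebra with $a\circ_\lambda(b\circ_\mu c)=(a\circ_\lambda b)\circ_{\lambda+\mu}c$ and $a\circ_\lambda b=b\circ_{-\partial-\lambda}a$ for all $a,b,c$. A Lie conformal algebra $(A,[\cdot_\lambda\cdot])$ is a conformal algebra (with product written $[a_\lambda b]$) such that $[a_\lambda b]=-[b_{-\lambda-\partial}a]$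 and $[a_\lambda[b_\mu c]]=[[a_\lambda b]_{\lambda+\mu}c]+[b_\mu[a_\lambda c]]$ for all $a,b,c$. A transposed Poisson conformal algebra (TPCA) is a $\mathbb{C}[\partial]$-module $\mathcal{L}$ with $\mathbb{C}$-bilinear maps $\circ_\lambda,[\cdot_\lambda\cdot]:\mathcal{L}\otimes\mathcal{L}\to\mathcal{L}[\lambda]$ such that $(\mathcal{L},\circ_\lambda)$ is a commutative associative conformal algebra, $(\mathcal{L},[\cdot_\lambda\cdot])$ is a Lie conformal algebra, and $2(a\circ_\lambda[b_\mu c])=[(a\circ_\lambda b)_{\lambda+\mu}c]+[b_\mu(a\circ_\lambda c)]$ for all $a,b,c\in\mathcal{L}$. *)

(* Defs.v *)
From HB Require Import structures.
From mathcomp Require Import all_boot all_order all_algebra.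
From mathcomp Require Import finmap reals complex.
From mathcomp.multinomials Require Import monalg.

Set Implicit Arguments.
Unset Strict Implicit.
Unset Printing Implicit Defensive.

Import GRing.Theory.

Local Open Scope fset_scope.
Local Open Scope ring_scope.

(* Polynomials with coefficients in an R-module L and exponents in the        *)
(* monomials K, as a module over the polynomial ring {malg R[K]}. This is an  *)
(* alias of {malg L[K]} because the latter, when L is R itself, already has   *)
(* another scalar multiplication, by R.                                       *)
Definition pmod (R : nzRingType) (K : conomType) (L : lmodType R) : Type :=
  {malg L[K]}.

Section PolyModule.
Context {R : nzRingType} {K : conomType} {L : lmodType R}.
Implicit Types (p q : {malg R[K]}) (v w : {malg L[K]}).

HB.instance Definition _ := GRing.Zmodule.on (pmod K L).

Definition pscale p v : {malg L[K]} :=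
  \sum_(j <- msupp p) \sum_(k <- msupp v)
    << p@_j *: v@_k *g mmul j k >>.

Lemma pscalew (d e : {fset K}) p v : msupp p `<=` d -> msupp v `<=` e ->
  pscale p v = \sum_(j <- d) \sum_(k <- e) << p@_j *: v@_k *g mmul j k >>.
Proof.
move=> le_d le_e; rewrite /pscale (big_fset_incl _ le_d) /=.
  apply: eq_bigr => j _; apply: big_fset_incl => // k _ /mcoeff_outdom ->.
  by rewrite scaler0 monalgU0.
move=> j _ /mcoeff_outdom pj.
by rewrite big1 // => k _; rewrite pj scale0r monalgU0.
Qed.

Lemma pscaleDl v p q : pscale (p + q) v = pscale p v + pscale q v.
Proof.
rewrite (pscalew (msuppD_le p q) (fsubset_refl _)).
rewrite (pscalew (fsubsetUl _ (msupp q)) (fsubset_refl (msupp v))).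
rewrite (pscalew (fsubsetUr (msupp p) _) (fsubset_refl (msupp v))).
rewrite -big_split /=; apply: eq_bigr => j _.
rewrite -big_split /=; apply: eq_bigr => k _.
by rewrite mcoeffD scalerDl monalgUD.
Qed.

Lemma pscaleDr p v w : pscale p (v + w) = pscale p v + pscale p w.
Proof.
rewrite (pscalew (fsubset_refl _) (msuppD_le v w)).
rewrite (pscalew (fsubset_refl (msupp p)) (fsubsetUl _ (msupp w))).
rewrite (pscalew (fsubset_refl (msupp p)) (fsubsetUr (msupp v) _)).
rewrite -big_split /=; apply: eq_bigr => j _.
rewrite -big_split /=; apply: eq_bigr => k _.
by rewrite mcoeffD scalerDr monalgUD.
Qed.

Lemma pscale0p v : pscale 0 v = 0.
Proof. by rewrite /pscale msupp0 big_seq_fset0. Qed.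

Lemma pscalep0 p : pscale p 0 = 0.
Proof. by rewrite /pscale big1 // => j _; rewrite msupp0 big_seq_fset0. Qed.

Lemma pscaleUU (r : R) (x : L) (j k : K) :
  pscale << r *g j >> << x *g k >> = << r *: x *g mmul j k >>.
Proof. by rewrite (pscalew msuppU_le msuppU_le) !big_seq_fset1 !mcoeffUU. Qed.

Lemma pscale_suml (I : Type) (s : seq I) (F : I -> {malg R[K]}) v :
  pscale (\sum_(i <- s) F i) v = \sum_(i <- s) pscale (F i) v.
Proof. exact: (big_morph (pscale^~ v) (pscaleDl v) (pscale0p v)). Qed.

Lemma pscale_sumr (I : Type) (s : seq I) p (F : I -> {malg L[K]}) :
  pscale p (\sum_(i <- s) F i) = \sum_(i <- s) pscale p (F i).
Proof. exact: (big_morph (pscale p) (pscaleDr p) (pscalep0 p)). Qed.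

Lemma pscaleA p q v : pscale p (pscale q v) = pscale (p * q) v.
Proof.
rewrite (monalgE p) mulr_suml !pscale_suml; apply: eq_bigr => i _.
rewrite (monalgE q) mulr_sumr !pscale_suml pscale_sumr; apply: eq_bigr => j _.
rewrite (monalgE v) !pscale_sumr; apply: eq_bigr => k _.
rewrite !pscaleUU.
have -> : << p@_i *g i >> * << q@_j *g j >> = << p@_i * q@_j *g mmul i j >>.
  exact: fgmulUU.
by rewrite pscaleUU scalerA mulmA.
Qed.

Lemma pscale1p v : pscale 1 v = v.
Proof.
rewrite [RHS]monalgE {1}(monalgE v) pscale_sumr; apply: eq_bigr => k _.
by rewrite -[1]/(<< 1 *g mone >> : {malg R[K]}) pscaleUU scale1r mul1m.
Qed.

HB.instance Definition _ :=
  GRing.Zmodule_isLmodule.Build {malg R[K]} (pmod K L)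
    pscaleA pscale1p pscaleDr pscaleDl.

Definition pconst (x : L) : pmod K L := << x *g mone >>.

(* An operation L -> L -> L[t] is represented by its coefficients: for        *)
(* w : {malg L[nat]}, the coefficient of t^n is w@_n. Then psubst P w is      *)
(* \sum_n P^n w_n. As R will be C[partial], the subscript P may involve       *)
(* partial, which thus acts on the coefficients w_n.                          *)
Definition psubst (P : {malg R[K]}) (w : {malg L[nat]}) : pmod K L :=
  \sum_(n <- msupp w) P ^+ n *: pconst w@_n.

(* The product with subscript P, extended to L[K] linearly with respect to    *)
(* the formal variables.                                                      *)
Definition pprod (f : L -> L -> {malg L[nat]}) (P : {malg R[K]})
    (v w : pmod K L) : pmod K L :=
  \sum_(j <- msupp v) \sum_(k <- msupp w)
    (<< mmul j k >> : {malg R[K]}) *: psubst P (f v@_j w@_k).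

End PolyModule.

Notation "x %:V" := (pconst x) (at level 2, left associativity, format "x %:V")
  : ring_scope.

(* C[partial][lambda, mu, gamma], where C = R[i]. *)
Notation scalars R := {malg {poly R[i]}['X_{1..3}]}.

HB.lock Definition partial (R : realType) : scalars R := 'X%:MP.
HB.lock Definition lambda (R : realType) : scalars R :=
  << ucm (@Ordinal 3 0 isT) >>.
HB.lock Definition mu (R : realType) : scalars R :=
  << ucm (@Ordinal 3 1 isT) >>.
HB.lock Definition gamma (R : realType) : scalars R :=
  << ucm (@Ordinal 3 2 isT) >>.
Arguments partial {R}.
Arguments lambda {R}.
Arguments mu {R}.
Arguments gamma {R}.

Section Conformal.
Context {R : realType}.

(* A C[partial]-module: partial acts as 'X *: _ and c in C as c%:P *: _.      *)
Context {L : lmodType {poly R[i]}}.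
Implicit Types (f : L -> L -> {malg L[nat]}) (a b c : L).

(* L[lambda, mu, gamma]; it contains L[lambda] and L[lambda, mu], so that all *)
(* the identities below can be stated in it.                                  *)
Definition formal := pmod 'X_{1..3} L.

Definition prod_at f (v w : formal) (P : scalars R) : formal := pprod f P v w.

Record complex_bilinear f : Prop := ComplexBilinear {
  cbilinearDl : forall a a' b, f (a + a') b = f a b + f a' b;
  cbilinearDr : forall a b b', f a (b + b') = f a b + f a b';
  cbilinearZl : forall (r : R[i]) a b n,
    (f (r%:P *: a) b)@_n = r%:P *: (f a b)@_n;
  cbilinearZr : forall (r : R[i]) a b n,
    (f a (r%:P *: b))@_n = r%:P *: (f a b)@_n }.

Record conformal f : Prop := Conformal {
  conformal_bilinear : complex_bilinear f;
  conformalDl : forall a b,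
    prod_at f ('X *: a)%:V b%:V lambda
      = - lambda *: prod_at f a%:V b%:V lambda;
  conformalDr : forall a b,
    prod_at f a%:V ('X *: b)%:V lambda
      = (partial + lambda) *: prod_at f a%:V b%:V lambda }.

Record comm_assoc_conformal f : Prop := CommAssocConformal {
  comm_assoc_is_conformal : conformal f;
  conformal_assoc : forall a b c,
    prod_at f a%:V (prod_at f b%:V c%:V mu) lambda
      = prod_at f (prod_at f a%:V b%:V lambda) c%:V (lambda + mu);
  conformal_comm : forall a b,
    prod_at f a%:V b%:V lambda = prod_at f b%:V a%:V (- partial - lambda) }.

Record lie_conformal f : Prop := LieConformal {
  lie_is_conformal : conformal f;
  conformal_skew : forall a b,
    prod_at f a%:V b%:V lambda = - prod_at f b%:V a%:V (- lambda - partial);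
  conformal_jacobi : forall a b c,
    prod_at f a%:V (prod_at f b%:V c%:V mu) lambda
      = prod_at f (prod_at f a%:V b%:V lambda) c%:V (lambda + mu)
        + prod_at f b%:V (prod_at f a%:V c%:V lambda) mu }.

End Conformal.

Arguments formal {R} L.

HB.mixin Record isTransposedPoisson (R : realType) L
    of GRing.Lmodule {poly R[i]} L := {
  circ : L -> L -> {malg L[nat]};
  lie : L -> L -> {malg L[nat]};
  circ_comm_assoc : comm_assoc_conformal circ;
  lie_is_lie : lie_conformal lie;
  transposed_leibniz : forall a b c : L,
    (prod_at circ a%:V (prod_at lie b%:V c%:V mu) lambda) *+ 2
      = prod_at lie (prod_at circ a%:V b%:V lambda) c%:V (lambda + mu)
        + prod_at lie b%:V (prod_at circ a%:V c%:V lambda) mu }.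

#[short(type="tpcaType")]
HB.structure Definition TPCA (R : realType) :=
  { L of isTransposedPoisson R L & GRing.Lmodule {poly R[i]} L }.

(* Elements of L are used as constant polynomials. *)
Definition tpca_const (R : realType) (L : tpcaType R) (x : TPCA.sort L) :
  formal L := x%:V.
Coercion tpca_const : TPCA.sort >-> formal.

Notation "a \circ_( P ) b" := (prod_at circ a b P)
  (at level 40, P at level 200, b at level 39, format "a  \circ_( P )  b")
  : ring_scope.
Notation "\[ a , b \]_( P )" := (prod_at lie a b P)
  (at level 0, a, b, P at level 200, format "\[ a ,  b  \]_( P )")
  : ring_scope.

(* Main.v *)
Require Import Defs.
From HB Require Import structures.
From mathcomp Require Import all_boot all_order all_algebra.
From mathcomp Require Import finmap reals complex.
From mathcomp.multinomials Require Import monalg.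

(** In a transposed Poisson algebra, that is, without formal variables, all the
    identities follow in a few lines from 2 a[b,w] = [ab,w] + [b,aw].  Three
    instances of it add up to a[b,w] - b[a,w] + [a,b]w = 0, which is the first
    identity and, reordered, the second one.  Let X and Y be the left sides of
    the third and the fourth.  Multiplying the Jacobi identity by h yields
    X + Y = 0, and expanding 2 X yields 2 X + Y = 0, so that both vanish.  Twice
    the fifth identity is a combination of the first and the third; the sixth
    computes 4 u(v[x,y]) in two ways; the last combines three instances of the
    first.  A conformal algebra behaves like an ordinary one in which each
    argument carries a momentum, namely its formal variable, and the momenta of
    all arguments add up to - partial.

    By commutativity and skew-symmetry every term can be rewritten so that the
    last argument, whose momentum is minus partial minus the other momenta, is
    the rightmost factor; then no subscript involves partial any more.  For
    subscripts p, q free of partial the axioms read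
      a_p (b_q w) = (a_p b)_{p+q} w,
      [a_p [b_q w]] = [[a_p b]_{p+q} w] + [b_q [a_p w]],
      2 a_p [b_q w] = [(a_p b)_{p+q} w] + [b_q (a_p w)],
    and one more rule is needed, for a multiplier in the last place:
      2 [a_p b]_{p+q} w = [a_p (b_q w)] - [b_q (a_p w)].
    It is the compatibility axiom with the multiplier given the momentum
    - partial - p - q (leibniz_right).  Here partial is the total one, acting on
    the result of the whole expression, whereas commutativity of the inner
    product produces the partial of that inner product; the relations
    (partial v)_P w = - P v_P w and v_P (partial w) = (partial + P) v_P w convert
    one into the other.

    The rules hold for all formal arguments and all such p, q since they hold for
    constant arguments and the indeterminates lambda and mu: evaluation of lambda
    and mu at p and q transports the axioms (ev_prod_prodr, ev_prod_prodl), and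
    linearity with respect to monomials does the rest (monomial_linear_ext).
    The rules are collected in transposed_poisson_rules, over an arbitrary abelian
    group of momenta, and symmetrised_identities derives the seven identities
    from them. *)

Set Implicit Arguments.
Unset Strict Implicit.
Unset Printing Implicit Defensive.

Import GRing.Theory.

Local Open Scope fset_scope.
Local Open Scope ring_scope.

(** * Additivity of the substituted products *)

Section PolyModuleTheory.
Context {R : nzRingType} {K : conomType} {L : lmodType R}.
Implicit Types (P : {malg R[K]}) (v w : pmod K L) (x y : L).

Lemma scale_monomial (r : R) x (j k : K) :
  (<< r *g j >> : {malg R[K]}) *: (<< x *g k >> : pmod K L)
    = << r *: x *g mmul j k >>.
Proof. exact: pscaleUU. Qed.

Lemma pconstZ (r : R) x : (r *: x)%:V = (r%:MP : {malg R[K]}) *: (x%:V : pmod K L).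
Proof. by rewrite scale_monomial mul1m. Qed.

(** Sums over any finite set containing the support allow the supports of
    several arguments to be replaced by a common one. *)
Lemma psubstEw P (e : {fset nat}) (s : {malg L[nat]}) : msupp s `<=` e ->
  psubst P s = \sum_(n <- e) P ^+ n *: (s@_n)%:V.
Proof.
move=> le_e; apply: big_fset_incl => // n _ /mcoeff_outdom ->.
by rewrite /pconst monalgU0 scaler0.
Qed.

Lemma psubstD P (s t : {malg L[nat]}) : psubst P (s + t) = psubst P s + psubst P t.
Proof.
rewrite (psubstEw P (msuppD_le s t)).
rewrite (psubstEw P (fsubsetUl _ (msupp t))) (psubstEw P (fsubsetUr (msupp s) _)).
rewrite -big_split; apply: eq_bigr => n _ /=.
by rewrite mcoeffD /pconst monalgUD scalerDr.
Qed.

Lemma psubst0 P : psubst P (0 : {malg L[nat]}) = 0.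
Proof. by rewrite /psubst msupp0 big_seq_fset0. Qed.

Lemma scale_sum P v :
  P *: v = \sum_(k <- msupp P) (<< P@_k *g k >> : {malg R[K]}) *: v.
Proof. by rewrite -scaler_suml -monalgE. Qed.

Section Biadditive.
Variable f : L -> L -> {malg L[nat]}.
Hypotheses (fDl : forall x x' y, f (x + x') y = f x y + f x' y)
           (fDr : forall x y y', f x (y + y') = f x y + f x y').

Let f0l y : f 0 y = 0.
Proof. by apply: (addrI (f 0 y)); rewrite -fDl !addr0. Qed.

Let f0r x : f x 0 = 0.
Proof. by apply: (addrI (f x 0)); rewrite -fDr !addr0. Qed.

Lemma pprodEw P v w (d e : {fset K}) : msupp v `<=` d -> msupp w `<=` e ->
  pprod f P v w = \sum_(j <- d) \sum_(k <- e)
    (<< mmul j k >> : {malg R[K]}) *: psubst P (f v@_j w@_k).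
Proof.
move=> le_d le_e; rewrite /pprod (big_fset_incl _ le_d) /=.
  apply: eq_bigr => j _; apply: big_fset_incl => // k _ /mcoeff_outdom ->.
  by rewrite f0r psubst0 scaler0.
move=> j _ /mcoeff_outdom vj.
by rewrite big1 // => k _; rewrite vj f0l psubst0 scaler0.
Qed.

Lemma pprodDl P v v' w : pprod f P (v + v') w = pprod f P v w + pprod f P v' w.
Proof.
rewrite (pprodEw P (msuppD_le v v') (fsubset_refl _)).
rewrite (pprodEw P (fsubsetUl _ (msupp v')) (fsubset_refl (msupp w))).
rewrite (pprodEw P (fsubsetUr (msupp v) _) (fsubset_refl (msupp w))).
rewrite -big_split; apply: eq_bigr => j _ /=.
rewrite -big_split; apply: eq_bigr => k _ /=.
by rewrite mcoeffD fDl psubstD scalerDr.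
Qed.

Lemma pprodDr P v w w' : pprod f P v (w + w') = pprod f P v w + pprod f P v w'.
Proof.
rewrite (pprodEw P (fsubset_refl _) (msuppD_le w w')).
rewrite (pprodEw P (fsubset_refl (msupp v)) (fsubsetUl _ (msupp w'))).
rewrite (pprodEw P (fsubset_refl (msupp v)) (fsubsetUr (msupp w) _)).
rewrite -big_split; apply: eq_bigr => j _ /=.
rewrite -big_split; apply: eq_bigr => k _ /=.
by rewrite mcoeffD fDr psubstD scalerDr.
Qed.

Lemma pprodUU P x y (j k : K) :
  pprod f P (<< x *g j >> : pmod K L) (<< y *g k >> : pmod K L)
    = (<< mmul j k >> : {malg R[K]}) *: psubst P (f x y).
Proof. by rewrite (pprodEw P msuppU_le msuppU_le) !big_seq_fset1 !mcoeffUU. Qed.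

End Biadditive.
End PolyModuleTheory.

Lemma additive_ext (R : nzRingType) (K : conomType) (L : lmodType R)
    (F G : pmod K L -> pmod K L) :
  {morph F : v w / v + w} -> {morph G : v w / v + w} ->
  (forall x k, F << x *g k >> = G << x *g k >>) -> forall v, F v = G v.
Proof.
move=> FD GD FG v.
have F0 : F 0 = 0 by apply: (addrI (F 0)); rewrite -FD !addr0.
have G0 : G 0 = 0 by apply: (addrI (G 0)); rewrite -GD !addr0.
rewrite (monalgE v) (big_morph F FD F0) (big_morph G GD G0).
by apply: eq_bigr => k _; apply: FG.
Qed.

Lemma monomialM (R : nzRingType) (K : conomType) (a b : R) (j k : K) :
  << a *g j >> * << b *g k >> = << a * b *g mmul j k >> :> {malg R[K]}.
Proof. exact: fgmulUU. Qed.

(** * Extension from constant arguments *)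

Section MonomialLinear.
Context {R : comNzRingType} {K : conomType} {L : lmodType R}.
Implicit Types F G : pmod K L -> pmod K L.

(** Linearity over the monomials is what remains of linearity over all scalars:
    products commute with formal variables but not with partial. *)
Record monomial_linear F : Prop := MonomialLinear {
  monomial_linearD : forall v w, F (v + w) = F v + F w;
  monomial_linearZ : forall k v,
    F ((<< k >> : {malg R[K]}) *: v) = (<< k >> : {malg R[K]}) *: F v }.

Lemma monomial_linear_ext F G : monomial_linear F -> monomial_linear G ->
  (forall x, F x%:V = G x%:V) -> forall v, F v = G v.
Proof.
move=> [FD FZ] [GD GZ] FG; apply: additive_ext => // x k.
have -> : << x *g k >> = (<< k >> : {malg R[K]}) *: (x%:V : pmod K L).
  by rewrite scale_monomial scale1r mulm1.
by rewrite FZ GZ FG.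
Qed.

Lemma monomial_linear_id : monomial_linear id.
Proof. by []. Qed.

Lemma monomial_linear_add F G : monomial_linear F -> monomial_linear G ->
  monomial_linear (fun v => F v + G v).
Proof.
move=> [FD FZ] [GD GZ]; split=> [v w|k v]; first by rewrite FD GD addrACA.
by rewrite FZ GZ scalerDr.
Qed.

Lemma monomial_linear_scale Q F : monomial_linear F ->
  monomial_linear (fun v => Q *: F v).
Proof.
move=> [FD FZ]; split=> [v w|k v]; first by rewrite FD scalerDr.
by rewrite FZ scalerA mulrC -scalerA.
Qed.

Lemma monomial_linear_opp F : monomial_linear F -> monomial_linear (fun v => - F v).
Proof.
move=> [FD FZ]; split=> [v w|k v]; first by rewrite FD opprD.
by rewrite FZ scalerN.
Qed.

Lemma monomial_linear_muln n F : monomial_linear F ->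
  monomial_linear (fun v => F v *+ n).
Proof.
move=> [FD FZ]; split=> [v w|k v]; first by rewrite FD mulrnDl.
by rewrite FZ scalerMnr.
Qed.

End MonomialLinear.

(** * Products as functions of formal arguments *)

(** The product and the evaluations are sealed, so that terms built from them are
    compared by their shape and not by the finite sums that define them. *)
HB.lock Definition cprod (C : comNzRingType) (K : conomType)
    (L : lmodType {poly C}) (f : L -> L -> {malg L[nat]}) (P : {malg {poly C}[K]})
    (v w : pmod K L) : pmod K L := pprod f P v w.

(** Evaluation of the formal variables; the values may involve partial, which then
    acts on the coefficients. *)
HB.lock Definition ev_formal (C : comNzRingType) (K : conomType) (L : lmodType {poly C})
    (h : K -> {malg {poly C}[K]}) (v : pmod K L) : pmod K L :=
  \sum_(k <- msupp v) h k *: (v@_k)%:V.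

HB.lock Definition ev_scalar (C : comNzRingType) (K : conomType)
    (h : K -> {malg {poly C}[K]}) (p : {malg {poly C}[K]}) : {malg {poly C}[K]} :=
  mmap malgC h p.

Section BaseBilinear.
Context {C : comNzRingType} {K : conomType} {L : lmodType {poly C}}.
Local Notation scal := {malg {poly C}[K]}.

Record base_bilinear (f : L -> L -> {malg L[nat]}) : Prop := BaseBilinear {
  base_bilinearDl : forall x x' y, f (x + x') y = f x y + f x' y;
  base_bilinearDr : forall x y y', f x (y + y') = f x y + f x y';
  base_bilinearZl : forall (r : C) x y n,
    (f (r%:P *: x) y)@_n = r%:P *: (f x y)@_n;
  base_bilinearZr : forall (r : C) x y n,
    (f x (r%:P *: y))@_n = r%:P *: (f x y)@_n }.

Lemma psubstZ (P : scal) (r : C) (s t : {malg L[nat]}) :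
  (forall n, t@_n = r%:P *: s@_n) ->
  psubst P t = (r%:P)%:MP *: (psubst P s : pmod K L).
Proof.
move=> tE; have le_ts : msupp t `<=` msupp s.
  apply/fsubsetP => n; rewrite -!mcoeff_neq0 tE.
  by apply: contraNneq => ->; rewrite scaler0.
rewrite (psubstEw P le_ts) scaler_sumr; apply: eq_bigr => n _.
by rewrite tE scalerA [_ * P ^+ n]mulrC -scalerA [in RHS]scale_monomial mul1m.
Qed.

(** The subring C[K] of C[partial][K]. *)
Definition partial_free (q : scal) := forall k, exists r : C, q@_k = r%:P.

Section Products.
Variable f : L -> L -> {malg L[nat]}.
Hypothesis f_bilin : base_bilinear f.
Implicit Types (P Q q : scal) (v w : pmod K L) (x y : L).

Lemma cprodDl P v v' w : cprod f P (v + v') w = cprod f P v w + cprod f P v' w.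
Proof.
rewrite !cprod.unlock.
exact: pprodDl (base_bilinearDl f_bilin) (base_bilinearDr f_bilin) P v v' w.
Qed.

Lemma cprodDr P v w w' : cprod f P v (w + w') = cprod f P v w + cprod f P v w'.
Proof.
rewrite !cprod.unlock.
exact: pprodDr (base_bilinearDl f_bilin) (base_bilinearDr f_bilin) P v w w'.
Qed.

Lemma cprodUU P x y (j k : K) :
  cprod f P (<< x *g j >> : pmod K L) (<< y *g k >> : pmod K L)
    = (<< mmul j k >> : scal) *: psubst P (f x y).
Proof.
rewrite !cprod.unlock.
exact: pprodUU (base_bilinearDl f_bilin) (base_bilinearDr f_bilin) P x y j k.
Qed.

Lemma cprod_const P x y : cprod f P x%:V y%:V = psubst P (f x y).
Proof. by rewrite /pconst cprodUU mulm1 scale1r. Qed.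

Lemma cprodZU_l P (r : C) (m : K) v w :
  cprod f P ((<< r%:P *g m >> : scal) *: v) w
    = (<< r%:P *g m >> : scal) *: cprod f P v w.
Proof.
move: v; apply: additive_ext => [v v'|v v'|x j];
  rewrite ?scalerDr ?cprodDl ?scalerDr //.
move: w; apply: additive_ext => [w w'|w w'|y k];
  rewrite ?cprodDr ?scalerDr //.
rewrite scale_monomial !cprodUU (psubstZ P (base_bilinearZl f_bilin r x y)).
rewrite scalerA [in RHS]scalerA !monomialM; congr (_ *: _).
by rewrite mulr1 mul1r mulm1 mulmA.
Qed.

Lemma cprodZU_r P (r : C) (m : K) v w :
  cprod f P v ((<< r%:P *g m >> : scal) *: w)
    = (<< r%:P *g m >> : scal) *: cprod f P v w.
Proof.
move: v; apply: additive_ext => [v v'|v v'|x j];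
  rewrite ?cprodDl ?scalerDr //.
move: w; apply: additive_ext => [w w'|w w'|y k];
  rewrite ?scalerDr ?cprodDr ?scalerDr //.
rewrite scale_monomial !cprodUU (psubstZ P (base_bilinearZr f_bilin r x y)).
rewrite scalerA [in RHS]scalerA !monomialM; congr (_ *: _).
by rewrite mulr1 mul1r mulm1 mulmA [mmul j m]mulmC -mulmA.
Qed.

Lemma cprod_suml (I : Type) (e : seq I) (F : I -> pmod K L) P w :
  cprod f P (\sum_(i <- e) F i) w = \sum_(i <- e) cprod f P (F i) w.
Proof.
apply: (big_morph (fun u => cprod f P u w)) => [u u'|]; first exact: cprodDl.
by apply: (addrI (cprod f P 0 w)); rewrite -cprodDl !addr0.
Qed.

Lemma cprod_sumr (I : Type) (e : seq I) (F : I -> pmod K L) P v :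
  cprod f P v (\sum_(i <- e) F i) = \sum_(i <- e) cprod f P v (F i).
Proof.
apply: (big_morph (fun u => cprod f P v u)) => [u u'|]; first exact: cprodDr.
by apply: (addrI (cprod f P v 0)); rewrite -cprodDr !addr0.
Qed.

(** This fails for scalars that involve partial, see moves_l_partial. *)
Lemma cprodZ_l P q v w : partial_free q ->
  cprod f P (q *: v) w = q *: cprod f P v w.
Proof.
move=> q_free; rewrite (scale_sum q v) (scale_sum q (cprod f P v w)) cprod_suml.
by apply: eq_bigr => k _; have [r ->] := q_free k; apply: cprodZU_l.
Qed.

Lemma cprodZ_r P q v w : partial_free q ->
  cprod f P v (q *: w) = q *: cprod f P v w.
Proof.
move=> q_free; rewrite (scale_sum q w) (scale_sum q (cprod f P v w)) cprod_sumr.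
by apply: eq_bigr => k _; have [r ->] := q_free k; apply: cprodZU_r.
Qed.

Lemma monomial_linear_prodl P w F : monomial_linear F ->
  monomial_linear (fun v => cprod f P (F v) w).
Proof.
move=> [FD FZ]; split=> [v v'|k v]; first by rewrite FD cprodDl.
by rewrite FZ -cprodZU_l.
Qed.

Lemma monomial_linear_prodr P v F : monomial_linear F ->
  monomial_linear (fun w => cprod f P v (F w)).
Proof.
move=> [FD FZ]; split=> [w w'|k w]; first by rewrite FD cprodDr.
by rewrite FZ -cprodZU_r.
Qed.

(** A scalar Q that involves partial leaves the product as another scalar Q':
    partial acts on one factor before, and on the whole product after. *)
Definition moves_l P Q Q' :=
  forall v w, cprod f P (Q *: v) w = Q' *: cprod f P v w.

Definition moves_r P Q Q' :=
  forall v w, cprod f P v (Q *: w) = Q' *: cprod f P v w.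

Lemma moves_l_free P q : partial_free q -> moves_l P q q.
Proof. by move=> q_free v w; apply: cprodZ_l. Qed.

Lemma moves_r_free P q : partial_free q -> moves_r P q q.
Proof. by move=> q_free v w; apply: cprodZ_r. Qed.

Lemma moves_lB P Q1 Q1' Q2 Q2' :
  moves_l P Q1 Q1' -> moves_l P Q2 Q2' -> moves_l P (Q1 - Q2) (Q1' - Q2').
Proof.
move=> m1 m2 v w; rewrite !scalerBl; apply/eqP; rewrite eq_sym subr_eq.
by rewrite -m1 -m2 -cprodDl subrK.
Qed.

Lemma moves_rB P Q1 Q1' Q2 Q2' :
  moves_r P Q1 Q1' -> moves_r P Q2 Q2' -> moves_r P (Q1 - Q2) (Q1' - Q2').
Proof.
move=> m1 m2 v w; rewrite !scalerBl; apply/eqP; rewrite eq_sym subr_eq.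
by rewrite -m1 -m2 -cprodDr subrK.
Qed.

(** Subscripts of this shape are the ones that commutativity produces: D is
    partial, q the momentum of the other factor. *)
Lemma moves_l_conjugate P D D' q : moves_l P D D' -> partial_free q ->
  moves_l P (- D - q) (- D' - q).
Proof.
move=> mD q_free; rewrite -[- D]sub0r -[- D']sub0r.
apply: moves_lB (moves_l_free _ q_free); apply: moves_lB mD.
by apply: moves_l_free => k; exists 0; rewrite mcoeff0.
Qed.

Lemma moves_r_conjugate P D D' q : moves_r P D D' -> partial_free q ->
  moves_r P (- D - q) (- D' - q).
Proof.
move=> mD q_free; rewrite -[- D]sub0r -[- D']sub0r.
apply: moves_rB (moves_r_free _ q_free); apply: moves_rB mD.
by apply: moves_r_free => k; exists 0; rewrite mcoeff0.
Qed.

Lemma moves_l_const P (c : {poly C}) Q :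
  (forall x y, cprod f P (c *: x)%:V y%:V = Q *: cprod f P x%:V y%:V) ->
  moves_l P c%:MP Q.
Proof.
move=> mc v w.
move: v; apply: additive_ext => [v v'|v v'|x j];
  rewrite ?scalerDr ?cprodDl ?scalerDr //.
move: w; apply: additive_ext => [w w'|w w'|y k];
  rewrite ?cprodDr ?scalerDr //.
rewrite scale_monomial mul1m !cprodUU -!cprod_const mc.
by rewrite scalerA [in RHS]scalerA mulrC.
Qed.

Lemma moves_r_const P (c : {poly C}) Q :
  (forall x y, cprod f P x%:V (c *: y)%:V = Q *: cprod f P x%:V y%:V) ->
  moves_r P c%:MP Q.
Proof.
move=> mc v w.
move: v; apply: additive_ext => [v v'|v v'|x j];
  rewrite ?cprodDl ?scalerDr //.
move: w; apply: additive_ext => [w w'|w w'|y k];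
  rewrite ?scalerDr ?cprodDr ?scalerDr //.
rewrite scale_monomial mul1m !cprodUU -!cprod_const mc.
by rewrite scalerA [in RHS]scalerA mulrC.
Qed.

Lemma moves_lX P Q Q' n : moves_l P Q Q' -> moves_l P (Q ^+ n) (Q' ^+ n).
Proof.
move=> m; elim: n => [|n IHn] v w; first by rewrite !expr0 !scale1r.
by rewrite exprS -scalerA m IHn scalerA -exprS.
Qed.

Lemma moves_rX P Q Q' n : moves_r P Q Q' -> moves_r P (Q ^+ n) (Q' ^+ n).
Proof.
move=> m; elim: n => [|n IHn] v w; first by rewrite !expr0 !scale1r.
by rewrite exprS -scalerA m IHn scalerA -exprS.
Qed.

Lemma cprod_psubst_l P Q Q' (s : {malg L[nat]}) w : moves_l P Q Q' ->
  cprod f P (psubst Q s) w = \sum_(n <- msupp s) Q' ^+ n *: cprod f P (s@_n)%:V w.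
Proof.
move=> m; rewrite /psubst cprod_suml.
by apply: eq_bigr => n _; apply: moves_lX.
Qed.

Lemma cprod_psubst_r P Q Q' (s : {malg L[nat]}) v : moves_r P Q Q' ->
  cprod f P v (psubst Q s) = \sum_(n <- msupp s) Q' ^+ n *: cprod f P v (s@_n)%:V.
Proof.
move=> m; rewrite /psubst cprod_sumr.
by apply: eq_bigr => n _; apply: moves_rX.
Qed.

(** * Evaluation of the formal variables *)

Section Evaluation.
Variable h : {mmorphism K -> scal}.
Local Notation ev_formal := (@ev_formal C K L h).
Local Notation ev_scalar := (@ev_scalar C K h).

Lemma evEw v (e : {fset K}) : msupp v `<=` e ->
  ev_formal v = \sum_(k <- e) h k *: (v@_k)%:V.
Proof.
move=> le_e; rewrite ev_formal.unlock; apply: big_fset_incl => // k _ /mcoeff_outdom ->.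
by rewrite /pconst monalgU0 scaler0.
Qed.

Lemma evD v w : ev_formal (v + w) = ev_formal v + ev_formal w.
Proof.
rewrite (evEw (msuppD_le v w)).
rewrite (evEw (fsubsetUl _ (msupp w))) (evEw (fsubsetUr (msupp v) _)).
rewrite -big_split; apply: eq_bigr => k _ /=.
by rewrite mcoeffD /pconst monalgUD scalerDr.
Qed.

Lemma evU x k : ev_formal << x *g k >> = h k *: x%:V.
Proof. by rewrite (evEw msuppU_le) big_seq_fset1 mcoeffUU. Qed.

Lemma ev0 : ev_formal 0 = 0.
Proof. by apply: (addrI (ev_formal 0)); rewrite -evD !addr0. Qed.

Lemma evMn v n : ev_formal (v *+ n) = ev_formal v *+ n.
Proof. by elim: n => [|n IHn]; rewrite ?mulr0n ?ev0 // !mulrS evD IHn. Qed.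

Lemma evsX Q n : ev_scalar (Q ^+ n) = ev_scalar Q ^+ n.
Proof. by rewrite !ev_scalar.unlock rmorphXn. Qed.

Lemma evZ Q v : ev_formal (Q *: v) = ev_scalar Q *: ev_formal v.
Proof.
move: v; apply: additive_ext => [v w|v w|x k]; rewrite ?scalerDr ?evD ?scalerDr //.
rewrite scale_sum (big_morph ev_formal evD ev0) ev_scalar.unlock /mmap scaler_suml.
apply: eq_bigr => j _; rewrite scale_monomial !evU mmorphM.
rewrite pconstZ scalerA [in RHS]scalerA; congr (_ *: _).
by rewrite mulrC mulrA.
Qed.

Lemma ev_psubst Q (s : {malg L[nat]}) : ev_formal (psubst Q s) = psubst (ev_scalar Q) s.
Proof.
rewrite /psubst (big_morph ev_formal evD ev0); apply: eq_bigr => n _.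
by rewrite evZ evsX evU mmorph1 scale1r.
Qed.

(** The partial in Q acts on the inner product, but that in the values of h acts on
    the whole expression; so evaluating Q does not give the inner subscript Q' of
    the result.  Instead, Q' has to leave the outer product as the evaluation of
    Q1, the scalar as which Q leaves it. *)
Lemma ev_nest_r P Q Q1 Q' x (s : {malg L[nat]}) :
  moves_r P Q Q1 -> moves_r (ev_scalar P) Q' (ev_scalar Q1) ->
  ev_formal (cprod f P x%:V (psubst Q s)) = cprod f (ev_scalar P) x%:V (psubst Q' s).
Proof.
move=> m m'; rewrite (cprod_psubst_r _ _ m) (cprod_psubst_r _ _ m').
rewrite (big_morph ev_formal evD ev0); apply: eq_bigr => n _.
by rewrite evZ evsX !cprod_const ev_psubst.
Qed.

Lemma ev_nest_l P Q Q1 Q' x (s : {malg L[nat]}) :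
  moves_l P Q Q1 -> moves_l (ev_scalar P) Q' (ev_scalar Q1) ->
  ev_formal (cprod f P (psubst Q s) x%:V) = cprod f (ev_scalar P) (psubst Q' s) x%:V.
Proof.
move=> m m'; rewrite (cprod_psubst_l _ _ m) (cprod_psubst_l _ _ m').
rewrite (big_morph ev_formal evD ev0); apply: eq_bigr => n _.
by rewrite evZ evsX !cprod_const ev_psubst.
Qed.

End Evaluation.
End Products.
End BaseBilinear.

(** * The identities, from the rules for subscripts without partial *)

(** S is the group of momenta, d stands for partial, and admissible holds of the
    momenta free of partial.  Over abstract groups the identities become plain
    bookkeeping with sums. *)
Record transposed_poisson_rules (S M : zmodType) (d : S)
    (admissible : S -> Prop)
    (circ lie : S -> M -> M -> M) : Prop := TransposedPoissonRules {
  admissibleD : forall p q, admissible p -> admissible q -> admissible (p + q);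
  rules_circDr : forall p u, {morph circ p u : v w / v + w};
  rules_lieDl : forall p w, {morph (fun u => lie p u w) : u v / u + v};
  rules_lieDr : forall p u, {morph lie p u : v w / v + w};
  rules_comm : forall p u v, circ p u v = circ (- d - p) v u;
  rules_skew : forall p u v, lie p u v = - lie (- d - p) v u;
  rules_assoc : forall p q u v w, admissible p -> admissible q ->
    circ p u (circ q v w) = circ (p + q) (circ p u v) w;
  rules_jacobi : forall p q u v w, admissible p -> admissible q ->
    lie p u (lie q v w) = lie (p + q) (lie p u v) w + lie q v (lie p u w);
  rules_leibniz_left : forall p q u v w, admissible p -> admissible q ->
    circ p u (lie q v w) *+ 2 = lie (p + q) (circ p u v) w + lie q v (circ p u w);
  rules_leibniz_right : forall p q u v w, admissible p -> admissible q ->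
    circ (p + q) (lie p u v) w *+ 2 = lie p u (circ q v w) - lie q v (circ p u w);
  rules_flip_circ : forall p q u v w, admissible p -> admissible q ->
    circ (p + q) (circ p u v) w = circ (p + q) (circ q v u) w;
  rules_flip_lie : forall p q u v w, admissible p -> admissible q ->
    lie (p + q) (circ p u v) w = lie (p + q) (circ q v u) w;
  rules_torsion_free : forall v : M, v *+ 2 = 0 -> v = 0 }.

Section Identities.
Context {S M : zmodType} {d : S} {admissible : S -> Prop} {circ lie : S -> M -> M -> M}.
Hypothesis rules : transposed_poisson_rules d admissible circ lie.
Implicit Types (p q r : S) (a b h u v w x y : M).
Local Notation "u *_ P v" := (circ P u v)
  (at level 40, P at level 2, v at level 39, format "u  *_ P  v").
Local Notation "[ u , v ]_ P" := (lie P u v)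
  (at level 0, u, v at level 200, P at level 2, format "[ u ,  v ]_ P").

Let aD := admissibleD rules.

Let mulrn_morph (F : M -> M) : {morph F : u v / u + v} ->
  forall v, F (v *+ 2) = F v *+ 2.
Proof. by move=> FD v; rewrite !mulr2n FD. Qed.

Let zeroM (F : M -> M) : {morph F : u v / u + v} -> F 0 = 0.
Proof. by move=> FD; apply: (addrI (F 0)); rewrite -FD !addr0. Qed.

Let oppM (F : M -> M) : {morph F : u v / u + v} -> {morph F : u / - u}.
Proof. by move=> FD u; apply: (addrI (F u)); rewrite -FD !subrr zeroM. Qed.

Section TwoMomenta.
Variables p q : S.
Hypotheses (p_adm : admissible p) (q_adm : admissible q).

(** Twice the left side: the first two terms expand by the compatibility with
    the multiplier in front, the last one by that with the multiplier behind, and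
    everything cancels. *)
Lemma mixed_jacobi a b w :
  a *_p [b, w]_q - b *_q [a, w]_p + [a, b]_p *_(p + q) w = 0.
Proof.
apply: (rules_torsion_free rules); rewrite mulrnDl mulrnBl.
rewrite !(rules_leibniz_left rules) // (rules_leibniz_right rules) //.
rewrite [q + p]addrC -(rules_flip_lie rules a b) // opprD.
by rewrite [X in X + _]addrACA subrr add0r addrA subrK subrr.
Qed.

Lemma circ_left_comm u v w : u *_p (v *_q w) = v *_q (u *_p w).
Proof.
rewrite !(rules_assoc rules) // (rules_flip_circ rules) //.
by rewrite [q + p]addrC.
Qed.

End TwoMomenta.

Section ThreeMomenta.
Variables p q r : S.
Hypotheses (p_adm : admissible p) (q_adm : admissible q) (r_adm : admissible r).

(* The two sums occurring when the Jacobi identity for a, b, w is multiplied by  *)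
(* h: the multiplier lands on the inner bracket or on an argument of the outer   *)
(* bracket.                                                                      *)
Let h_on_inner_bracket h a b w :=
  [h *_p [a, b]_q, w]_(p + q + r) - [a, h *_p [b, w]_r]_q + [b, h *_p [a, w]_q]_r.

Let h_on_argument h a b w :=
  [[a, b]_q, h *_p w]_(q + r) - [h *_p a, [b, w]_r]_(p + q)
    + [h *_p b, [a, w]_q]_(p + r).

(** The compatibility rule distributes 2 h over each outer bracket of the Jacobi
    identity. *)
Let multiplied_jacobi h a b w :
  h_on_inner_bracket h a b w + h_on_argument h a b w = 0.
Proof.
have /(congr1 (fun v => (h *_p v) *+ 2)) := rules_jacobi rules a b w q_adm r_adm.
rewrite (rules_circDr rules) mulrnDl !(rules_leibniz_left rules); auto.
rewrite [p + (q + r)]addrA => E.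
rewrite /h_on_inner_bracket /h_on_argument.
by rewrite !addrA [LHS](ACl ((1 * 4) * (6 * 3) * (5 * 2)))%AC /= -opprD E subrr.
Qed.

(** Twice the first sum distributes h over the inner brackets; the resulting six
    terms are those of the Jacobi identities for (ha, b, w), (a, hb, w) and
    (a, b, hw), which leave the second sum with a minus sign. *)
Let multiplied_jacobi_twice h a b w :
  h_on_inner_bracket h a b w *+ 2 + h_on_argument h a b w = 0.
Proof.
rewrite /h_on_inner_bracket /h_on_argument.
rewrite mulrnDl mulrnBl.
rewrite -(mulrn_morph (rules_lieDl rules _ w)) -!(mulrn_morph (rules_lieDr rules _ _)).
rewrite !(rules_leibniz_left rules) //.
rewrite (rules_lieDl rules) !(rules_lieDr rules).
rewrite (rules_jacobi rules (h *_p a) b w); auto.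
rewrite (rules_jacobi rules a (h *_p b) w); auto.
rewrite (rules_jacobi rules a b (h *_p w)); auto.
rewrite [q + (p + r)]addrCA !opprD !addrA.
rewrite [LHS](ACl ((1*10)*(2*3)*(12*4)*(9*5)*(8*6)*(7*11)))%AC /=.
by rewrite !subrr !addr0.
Qed.

Lemma lie_circ_lie_cyclic h a b w :
  [h *_p [a, b]_q, w]_(p + q + r) - [a, h *_p [b, w]_r]_q
    + [b, h *_p [a, w]_q]_r = 0.
Proof.
have := multiplied_jacobi_twice h a b w.
by rewrite mulr2n -addrA multiplied_jacobi addr0.
Qed.

Lemma lie_lie_circ_cyclic h a b w :
  [[a, b]_q, h *_p w]_(q + r) - [h *_p a, [b, w]_r]_(p + q)
    + [h *_p b, [a, w]_q]_(p + r) = 0.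
Proof.
have := multiplied_jacobi h a b w.
by rewrite /h_on_inner_bracket lie_circ_lie_cyclic add0r.
Qed.

(** Doubled, the first two terms expand with [b, w] and [a, w] as multipliers
    behind, the third one with [a, b] as multiplier in front.  The outcome is
    [h, -] applied to mixed_jacobi for a, b, w, plus lie_circ_lie_cyclic. *)
Lemma circ_lie_lie_cyclic h a b w :
  [h, a]_p *_(p + q) [b, w]_r - [h, b]_p *_(p + r) [a, w]_q
    + [a, b]_q *_(q + r) [h, w]_p = 0.
Proof.
apply: (rules_torsion_free rules); rewrite mulrnDl mulrnBl.
rewrite !(rules_leibniz_right rules h) // (rules_leibniz_left rules); auto.
rewrite [q + r + p]addrC -(rules_flip_lie rules h [a, b]_q) ?addrA; auto.
rewrite opprB !addrA.
rewrite [LHS](ACl ((1*4*6)*(5*2*3)))%AC /=.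
rewrite lie_circ_lie_cyclic addr0.
rewrite -(oppM (rules_lieDr rules p h)) -!(rules_lieDr rules) mixed_jacobi //.
exact: zeroM (rules_lieDr rules p h).
Qed.

End ThreeMomenta.

Section Multipliers.
Variables p q r : S.
Hypotheses (p_adm : admissible p) (q_adm : admissible q) (r_adm : admissible r).

(** Four times u(v[x, y]), expanded through v first and u second, contains the
    left side and the expansion of twice (uv)[x, y]. *)
Lemma lie_circ_circ u v x y :
  [u *_p x, v *_q y]_(p + r) + [v *_q x, u *_p y]_(q + r)
    = ((u *_p v) *_(p + q) [x, y]_r) *+ 2.
Proof.
have E : ((u *_p v) *_(p + q) [x, y]_r) *+ 2 *+ 2
    = ((u *_p v) *_(p + q) [x, y]_r) *+ 2
      + ([u *_p x, v *_q y]_(p + r) + [v *_q x, u *_p y]_(q + r)).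
  rewrite -{1}(rules_assoc rules u v) // -(mulrn_morph (rules_circDr rules _ _)).
  rewrite (rules_leibniz_left rules) // (rules_circDr rules) mulrnDl.
  rewrite !(rules_leibniz_left rules) ?(rules_assoc rules) //; auto.
  rewrite !addrA [LHS](ACl ((1*4)*(3*2)))%AC /=.
  by rewrite !addrA.
by move/eqP: E; rewrite [X in X == _]mulr2n (inj_eq (addrI _)) => /eqP.
Qed.

(** Three instances of mixed_jacobi, for (x, u; vy), for (vx, u; y) and, multiplied
    by v, for (x, u; y), reduce the left side to 2 u(v[x, y]) - u(v[x, y]). *)
Lemma circ_lie_circ u v x y :
  x *_r [u, v *_q y]_p + [v *_q x, u]_(q + r) *_(q + r + p) y
    = (u *_p v) *_(p + q) [x, y]_r.
Proof.
have qr_adm := aD q_adm r_adm.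
have E1 := mixed_jacobi r_adm p_adm x u (v *_q y).
have E2 := mixed_jacobi qr_adm p_adm (v *_q x) u y.
have /(congr1 (circ q v)) := mixed_jacobi r_adm p_adm x u y.
rewrite !(rules_circDr rules) (oppM (rules_circDr rules _ _)).
rewrite (zeroM (rules_circDr rules _ _)) (rules_assoc rules v x) //.
rewrite (circ_left_comm q_adm (aD r_adm p_adm)) => E3.
have L2 : u *_p [v *_q x, y]_(q + r) + u *_p [x, v *_q y]_r
    = (v *_q (u *_p [x, y]_r)) *+ 2.
  rewrite -(rules_circDr rules) -(rules_leibniz_left rules) //.
  by rewrite (mulrn_morph (rules_circDr rules _ _)) circ_left_comm.
rewrite -(rules_assoc rules) // (circ_left_comm p_adm q_adm).
apply/eqP; rewrite -subr_eq0; apply/eqP.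
have := congr2 (fun s t => s - t) (congr2 +%R E1 E2) E3.
rewrite addr0 subr0 => <-; rewrite !opprD opprK !addrA.
rewrite [RHS](ACl ((1*6)*(5*2)*8*(3*9)*(4*7)))%AC /= !subrr !addr0.
by rewrite -opprD L2 mulr2n opprD addrA subrK.
Qed.

End Multipliers.

Section Symmetrised.
Variables l m g : S.
Hypotheses (l_adm : admissible l) (m_adm : admissible m) (g_adm : admissible g).
Hypotheses (ml_adm : admissible (m - l)) (mg_adm : admissible (m - g)).

Let comm p u v : u *_(- d - p) v = v *_p u.
Proof. by rewrite [RHS](rules_comm rules). Qed.

Let skew p u v : [u, v]_(- d - p) = - [v, u]_p.
Proof. by rewrite [in RHS](rules_skew rules) opprK. Qed.

Let subB p q : - d - p + q = - d - (p - q).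
Proof. by rewrite opprB addrA addrAC. Qed.

Let circ_opp p u v : u *_p (- v) = - (u *_p v).
Proof. exact: oppM (rules_circDr rules p u) v. Qed.

Let lie_opp p u v : [u, - v]_p = - [u, v]_p.
Proof. exact: oppM (rules_lieDr rules p u) v. Qed.

(** Swapping the factors wherever the subscript contains d makes the last argument
    the rightmost one and turns cyclic sums into the alternating sums above. *)
Lemma symmetrised_identities x y z h u v :
  [/\ x *_l [y, z]_m + y *_m [z, x]_(- d - l) + z *_(- d - l - m) [x, y]_l = 0,
      [x, y]_l *_m z + [y, z]_(m - l) *_(- d - l) x
        + [z, x]_(- d - l) *_(- d - m + l) y = 0,
      [h *_l [x, y]_g, z]_(l + m) + [h *_l [y, z]_(m - g), x]_(- d - g)
        + [h *_l [z, x]_(- d - g), y]_(- d - m + g) = 0,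
      [[x, y]_g, h *_l z]_m + [[y, z]_(m - g), h *_l x]_(- d - l - g)
        + [[z, x]_(- d - g), h *_l y]_(- d - l - m + g) = 0 &
      [/\ [h, x]_l *_(l + g) [y, z]_(m - g)
            + [h, y]_l *_(l + m - g) [z, x]_(- d - g)
            + [h, z]_l *_(- d - m) [x, y]_g = 0,
          [u *_l x, v *_g y]_m + [v *_g x, u *_l y]_(g + m - l)
            = ((u *_l v) *_(l + g) [x, y]_(m - l)) *+ 2 &
          x *_(m - l) [u, v *_g y]_l + [v *_g x, u]_(g + m - l) *_(g + m) y
            = (u *_l v) *_(l + g) [x, y]_(m - l)]].
Proof.
have gmg : g + (m - g) = m by rewrite addrCA subrr addr0.
have lgm : l + g + (m - g) = l + m by rewrite -addrA gmg.
have lml : l + (m - l) = m by rewrite addrCA subrr addr0.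
rewrite !subB !opprK !comm !skew !circ_opp !lie_opp !opprK.
split.
- exact: mixed_jacobi.
- by have := mixed_jacobi l_adm ml_adm x y z; rewrite lml addrC addrA.
- by have := lie_circ_lie_cyclic l_adm g_adm mg_adm h x y z; rewrite lgm.
- by have := lie_lie_circ_cyclic l_adm g_adm mg_adm h x y z; rewrite gmg addrA.
split.
- by have := circ_lie_lie_cyclic l_adm g_adm mg_adm h x y z; rewrite gmg addrA.
- by have := lie_circ_circ l_adm g_adm ml_adm u v x y; rewrite lml addrA.
- have := circ_lie_circ l_adm g_adm ml_adm u v x y.
  by rewrite -[g + (m - l) + l]addrA subrK addrA.
Qed.

End Symmetrised.
End Identities.

(** * The rules, from the axioms *)

Section EvaluationMorphism.
Context {C : comNzRingType} {K : conomType} (h : {mmorphism K -> {malg {poly C}[K]}}).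

Lemma evs_const (c : {poly C}) : ev_scalar h c%:MP = c%:MP.
Proof. by rewrite ev_scalar.unlock mmapC. Qed.

Lemma evsD : {morph ev_scalar h : p q / p + q}.
Proof. by move=> p q; rewrite !ev_scalar.unlock rmorphD. Qed.

Lemma evsN : {morph ev_scalar h : p / - p}.
Proof. by move=> p; rewrite !ev_scalar.unlock rmorphN. Qed.

Lemma evs_sign (s : bool) : ev_scalar h ((-1) ^+ s) = (-1) ^+ s.
Proof. by rewrite !ev_scalar.unlock rmorph_sign. Qed.

End EvaluationMorphism.

Section ConformalProducts.
Context {C : comNzRingType} {K : conomType} {L : lmodType {poly C}}.
Local Notation scal := {malg {poly C}[K]}.
Local Notation d := ('X%:MP : scal).
(* l and m play the role of lambda and mu; at_lm P Q substitutes P and Q for them. *)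
Variables (l m : scal) (at_lm : scal -> scal -> {mmorphism K -> scal}).
Hypotheses (evs_l : forall P Q, ev_scalar (at_lm P Q) l = P).
Hypotheses (evs_m : forall P Q, ev_scalar (at_lm P Q) m = Q).
Hypotheses (l_free : partial_free l) (m_free : partial_free m).
Implicit Types (f g : L -> L -> {malg L[nat]}) (a b c : L).
Implicit Types (P p q r : scal) (u v w : pmod K L).

Lemma partial_freeD p q : partial_free p -> partial_free q -> partial_free (p + q).
Proof.
move=> p_free q_free k; have [r pk] := p_free k; have [s qk] := q_free k.
by exists (r + s); rewrite mcoeffD pk qk rmorphD.
Qed.

Lemma partial_freeB p q : partial_free p -> partial_free q -> partial_free (p - q).
Proof.
move=> p_free q_free k; have [r pk] := p_free k; have [s qk] := q_free k.
by exists (r - s); rewrite mcoeffB pk qk rmorphB.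
Qed.

Lemma ev_prod f a b P (h : {mmorphism K -> scal}) : base_bilinear f ->
  ev_formal h (cprod f P a%:V b%:V) = cprod f (ev_scalar h P) a%:V b%:V.
Proof. by move=> fb; rewrite !cprod_const // ev_psubst. Qed.

Record conformal_product f : Prop := ConformalProduct {
  conformal_product_bilinear : base_bilinear f;
  conformal_productDl : forall a b,
    cprod f l ('X *: a)%:V b%:V = - l *: cprod f l a%:V b%:V;
  conformal_productDr : forall a b,
    cprod f l a%:V ('X *: b)%:V = (d + l) *: cprod f l a%:V b%:V }.

Lemma moves_l_partial f P : conformal_product f -> moves_l f P d (- P).
Proof.
move=> [fb fDl _]; apply: (moves_l_const fb) => a b.
have /(congr1 (ev_formal (at_lm P 0))) := fDl a b.
by rewrite evZ !(ev_prod _ _ _ _ fb) evsN evs_l.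
Qed.

Lemma moves_r_partial f P : conformal_product f -> moves_r f P d (d + P).
Proof.
move=> [fb _ fDr]; apply: (moves_r_const fb) => a b.
have /(congr1 (ev_formal (at_lm P 0))) := fDr a b.
by rewrite evZ !(ev_prod _ _ _ _ fb) evsD evs_const evs_l.
Qed.

(** Commutativity and skew-symmetry at once. *)
Definition symmetric_up_to (s : bool) f := forall a b,
  cprod f l a%:V b%:V = (-1) ^+ s *: cprod f (- d - l) b%:V a%:V.

Lemma prod_swap_const s f a b P : base_bilinear f -> symmetric_up_to s f ->
  cprod f P a%:V b%:V = (-1) ^+ s *: cprod f (- d - P) b%:V a%:V.
Proof.
move=> fb f_sym; have /(congr1 (ev_formal (at_lm P 0))) := f_sym a b.
by rewrite evZ !(ev_prod _ _ _ _ fb) evsD !evsN evs_const evs_l evs_sign.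
Qed.

Ltac linear_in := repeat first [apply: monomial_linear_id | apply: monomial_linear_add
  | apply: monomial_linear_scale | apply: monomial_linear_opp
  | apply: monomial_linear_muln
  | apply: monomial_linear_prodl => // | apply: monomial_linear_prodr => // ].

Lemma prod_swap s f v w P : base_bilinear f -> symmetric_up_to s f ->
  cprod f P v w = (-1) ^+ s *: cprod f (- d - P) w v.
Proof.
move=> fb f_sym.
move: v; apply: monomial_linear_ext; [by linear_in|by linear_in|move=> a].
move: w; apply: monomial_linear_ext; [by linear_in|by linear_in|move=> b].
exact: prod_swap_const.
Qed.

(** Inside the left factor of a product with subscript p + q, partial acts as
    minus (p + q), so that - partial - p becomes q. *)
Lemma prod_flip f g u v w p q : conformal_product f -> base_bilinear g ->
  symmetric_up_to false g -> partial_free p -> partial_free q ->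
  cprod f (p + q) (cprod g p u v) w = cprod f (p + q) (cprod g q v u) w.
Proof.
move=> fc gb g_comm p_free q_free; have fb := conformal_product_bilinear fc.
move: u; apply: monomial_linear_ext; [by linear_in|by linear_in|move=> a].
move: v; apply: monomial_linear_ext; [by linear_in|by linear_in|move=> b].
rewrite (prod_swap_const a b p gb g_comm) expr0 scale1r !(cprod_const gb).
have mq := moves_l_free fb (p + q) q_free.
have mp := moves_l_conjugate fb (moves_l_partial (p + q) fc) p_free.
apply: etrans (cprod_psubst_l fb _ _ mp) (etrans _ (esym (cprod_psubst_l fb _ _ mq))).
by apply: eq_bigr => n _; rewrite opprK addrAC subrr add0r.
Qed.

Lemma ev_prod_prodr f g a b c P Q h : base_bilinear f -> base_bilinear g ->
  partial_free Q -> partial_free (ev_scalar (h : {mmorphism K -> scal}) Q) ->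
  ev_formal h (cprod f P a%:V (cprod g Q b%:V c%:V))
    = cprod f (ev_scalar h P) a%:V (cprod g (ev_scalar h Q) b%:V c%:V).
Proof.
move=> fb gb Q_free hQ_free; rewrite !(cprod_const gb).
by apply: (ev_nest_r fb); apply: moves_r_free.
Qed.

Lemma ev_prod_prodl f g a b c P Q h : base_bilinear f -> base_bilinear g ->
  partial_free Q -> partial_free (ev_scalar (h : {mmorphism K -> scal}) Q) ->
  ev_formal h (cprod f P (cprod g Q a%:V b%:V) c%:V)
    = cprod f (ev_scalar h P) (cprod g (ev_scalar h Q) a%:V b%:V) c%:V.
Proof.
move=> fb gb Q_free hQ_free; rewrite !(cprod_const gb).
by apply: (ev_nest_l fb); apply: moves_l_free.
Qed.

(** The axioms over an arbitrary coefficient ring, in the indeterminates l and m. *)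
Record transposed_poisson circ lie : Prop := TransposedPoisson {
  tp_circ : conformal_product circ;
  tp_lie : conformal_product lie;
  tp_comm : symmetric_up_to false circ;
  tp_skew : symmetric_up_to true lie;
  tp_assoc : forall a b c, cprod circ l a%:V (cprod circ m b%:V c%:V)
    = cprod circ (l + m) (cprod circ l a%:V b%:V) c%:V;
  tp_jacobi : forall a b c, cprod lie l a%:V (cprod lie m b%:V c%:V)
    = cprod lie (l + m) (cprod lie l a%:V b%:V) c%:V
      + cprod lie m b%:V (cprod lie l a%:V c%:V);
  tp_leibniz : forall a b c, cprod circ l a%:V (cprod lie m b%:V c%:V) *+ 2
    = cprod lie (l + m) (cprod circ l a%:V b%:V) c%:V
      + cprod lie m b%:V (cprod circ l a%:V c%:V) }.

Section Rules.
Variables circ lie : L -> L -> {malg L[nat]}.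
Hypothesis L_tp : transposed_poisson circ lie.
Local Notation "u *_ P v" := (cprod circ P u v)
  (at level 40, P at level 2, v at level 39, format "u  *_ P  v").
Local Notation "[ u , v ]_ P" := (cprod lie P u v)
  (at level 0, u, v at level 200, P at level 2, format "[ u ,  v ]_ P").

Let circ_conf := tp_circ L_tp.
Let lie_conf := tp_lie L_tp.
Let circ_bil := conformal_product_bilinear circ_conf.
Let lie_bil := conformal_product_bilinear lie_conf.

Lemma circA p q u v w : partial_free p -> partial_free q ->
  u *_p (v *_q w) = (u *_p v) *_(p + q) w.
Proof.
move=> p_free q_free.
move: u; apply: monomial_linear_ext; [by linear_in|by linear_in|move=> a].
move: v; apply: monomial_linear_ext; [by linear_in|by linear_in|move=> b].
move: w; apply: monomial_linear_ext; [by linear_in|by linear_in|move=> c].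
have /(congr1 (ev_formal (at_lm p q))) := tp_assoc L_tp a b c.
by rewrite ev_prod_prodr ?ev_prod_prodl ?evsD ?evs_l ?evs_m.
Qed.

Lemma lie_jacobi p q u v w : partial_free p -> partial_free q ->
  [u, [v, w]_q]_p = [[u, v]_p, w]_(p + q) + [v, [u, w]_p]_q.
Proof.
move=> p_free q_free.
move: u; apply: monomial_linear_ext; [by linear_in|by linear_in|move=> a].
move: v; apply: monomial_linear_ext; [by linear_in|by linear_in|move=> b].
move: w; apply: monomial_linear_ext; [by linear_in|by linear_in|move=> c].
have /(congr1 (ev_formal (at_lm p q))) := tp_jacobi L_tp a b c.
by rewrite evD !ev_prod_prodr ?ev_prod_prodl ?evsD ?evs_l ?evs_m.
Qed.

Lemma leibniz_left p q u v w : partial_free p -> partial_free q ->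
  (u *_p [v, w]_q) *+ 2 = [u *_p v, w]_(p + q) + [v, u *_p w]_q.
Proof.
move=> p_free q_free.
move: u; apply: monomial_linear_ext; [by linear_in|by linear_in|move=> a].
move: v; apply: monomial_linear_ext; [by linear_in|by linear_in|move=> b].
move: w; apply: monomial_linear_ext; [by linear_in|by linear_in|move=> c].
have /(congr1 (ev_formal (at_lm p q))) := tp_leibniz L_tp a b c.
by rewrite evD evMn !ev_prod_prodr ?ev_prod_prodl ?evsD ?evs_l ?evs_m.
Qed.

(** The compatibility axiom for c, a, b with l evaluated at z = - d - (p + q), the
    momentum left for the last factor, and m at p. *)
Lemma leibniz_right p q u v w : partial_free p -> partial_free q ->
  ([u, v]_p *_(p + q) w) *+ 2 = [u, v *_q w]_p - [v, u *_p w]_q.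
Proof.
move=> p_free q_free.
move: u; apply: monomial_linear_ext; [by linear_in|by linear_in|move=> a].
move: v; apply: monomial_linear_ext; [by linear_in|by linear_in|move=> b].
move: w; apply: monomial_linear_ext; [by linear_in|by linear_in|move=> c].
set z := - d - (p + q); have qE : - (d + p) - q = z by rewrite /z !opprD addrA.
have pE : - (- (- d - q)) - p = z by rewrite /z opprK opprD addrA [LHS]addrAC.
have /(congr1 (ev_formal (at_lm z p))) := tp_leibniz L_tp c a b.
rewrite evD evMn ev_prod_prodr ?evs_l ?evs_m //.
rewrite (prod_swap c%:V _ z circ_bil (tp_comm L_tp)) expr0 scale1r.
have -> : - d - z = p + q by rewrite /z opprD !opprK addKr.
(* The term [a, c b]: inside it, l = z is the subscript - partial - q of c b. *)
move=> ->; rewrite addrC; congr (_ + _).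
  rewrite (cprod_const circ_bil).
  have mq := moves_r_conjugate lie_bil (moves_r_partial p lie_conf) q_free.
  rewrite (ev_nest_r lie_bil _ _ (moves_r_free lie_bil _ l_free) (Q' := - d - q)).
    rewrite -(cprod_const circ_bil) evs_m; congr (cprod _ _ _ _).
    by rewrite [RHS](prod_swap _ _ _ circ_bil (tp_comm L_tp)) expr0 scale1r.
  by rewrite evs_l evs_m -qE.
rewrite (cprod_const circ_bil).
(* The term [c a, b]: its outer subscript z + p turns it into - [b, c a]. *)
have zpE : z + p = - d - q by rewrite /z opprD addrA addrAC subrK.
have mp := moves_l_conjugate lie_bil (moves_l_partial (- d - q) lie_conf) p_free.
rewrite (ev_nest_l lie_bil _ _ (moves_l_free lie_bil _ l_free) (Q' := - d - p)).
  rewrite -(cprod_const circ_bil) evsD evs_l evs_m zpE.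
  rewrite [RHS](congr1 -%R (prod_swap _ _ _ lie_bil (tp_skew L_tp))).
  rewrite expr1 scaleN1r opprK; congr (cprod _ _ _ _).
  rewrite [LHS](prod_swap _ _ _ circ_bil (tp_comm L_tp)) expr0 scale1r.
  by rewrite opprD !opprK addKr.
by rewrite evsD evs_l evs_m zpE -pE.
Qed.

Lemma conformal_rules : (forall x : L, x *+ 2 = 0 -> x = 0) ->
  transposed_poisson_rules d (@partial_free C K) (cprod circ) (cprod lie).
Proof.
move=> L_torsion_free; split.
- exact: partial_freeD.
- exact: cprodDr circ_bil.
- by move=> p w u v; apply: cprodDl.
- exact: cprodDr lie_bil.
- move=> p u v; rewrite [LHS](prod_swap _ _ _ circ_bil (tp_comm L_tp)).
  by rewrite expr0 scale1r.
- move=> p u v; rewrite [LHS](prod_swap _ _ _ lie_bil (tp_skew L_tp)).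
  by rewrite expr1 scaleN1r.
- by move=> p q u v w; apply: circA.
- by move=> p q u v w; apply: lie_jacobi.
- by move=> p q u v w; apply: leibniz_left.
- by move=> p q u v w; apply: leibniz_right.
- by move=> p q u v w; apply: prod_flip => //; apply: tp_comm L_tp.
- by move=> p q u v w; apply: prod_flip => //; apply: tp_comm L_tp.
(* Doubling is injective since it is so on every coefficient. *)
move=> v v2; apply/malgP => k; rewrite mcoeff0; apply: L_torsion_free.
by rewrite -mcoeffMn v2 mcoeff0.
Qed.

End Rules.
End ConformalProducts.

(** * Complex coefficients and three indeterminates *)

Section MonomialAt.
Context {I : choiceType} {S : comNzRingType}.
Variables (i j : I) (P Q : S).

(** The other indeterminates are sent to 1; they do not occur in the axioms. *)
Definition monomial_at (m : cmonom I) : S := P ^+ m i * Q ^+ m j.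

Lemma monomial_at_morph : mmorphism monomial_at.
Proof.
split=> [m n|]; last by rewrite /monomial_at !cm1 !expr0 mulr1.
by rewrite /monomial_at !cmM !exprD mulrACA.
Qed.

HB.instance Definition _ :=
  isMultiplicative.Build (cmonom I) S monomial_at monomial_at_morph.

End MonomialAt.

Section Indeterminates.
Context {C : comNzRingType} {I : choiceType}.
Implicit Types (P Q : {malg {poly C}[cmonom I]}) (i j k : I).

Lemma evs_var P Q i j k :
  ev_scalar (monomial_at i j P Q) << ucm k >> = monomial_at i j P Q (ucm k).
Proof.
by rewrite -[RHS]mul1r -(@mpolyC1E (cmonom I) {poly C}) ev_scalar.unlock [LHS]mmapU.
Qed.

Lemma evs_var_l P Q i j : i != j -> ev_scalar (monomial_at i j P Q) << ucm i >> = P.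
Proof. by move=> /negPf ij; rewrite evs_var /monomial_at !cmU eqxx ij mulr1. Qed.

Lemma evs_var_r P Q i j : i != j -> ev_scalar (monomial_at i j P Q) << ucm j >> = Q.
Proof.
by move=> /negPf ij; rewrite evs_var /monomial_at !cmU eqxx eq_sym ij mul1r.
Qed.

Lemma partial_free_var (k : I) : partial_free (<< ucm k >> : {malg {poly C}[cmonom I]}).
Proof. by move=> m; exists (ucm k == m)%:R; rewrite mcoeffU rmorph_nat. Qed.
End Indeterminates.

Section ComplexCoefficients.
Context {R : realType}.

Let lambda_mu_at (P Q : scalars R) : {mmorphism 'X_{1..3} -> scalars R} :=
  monomial_at (@Ordinal 3 0 isT) (@Ordinal 3 1 isT) P Q.

Lemma evs_lambda P Q : ev_scalar (lambda_mu_at P Q) lambda = P.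
Proof. by rewrite lambda.unlock evs_var_l. Qed.

Lemma evs_mu P Q : ev_scalar (lambda_mu_at P Q) mu = Q.
Proof. by rewrite mu.unlock evs_var_r. Qed.

Lemma partial_free_lambda : partial_free (@lambda R).
Proof. by rewrite unlock; apply: partial_free_var. Qed.

Lemma partial_free_mu : partial_free (@mu R).
Proof. by rewrite unlock; apply: partial_free_var. Qed.

Lemma partial_free_gamma : partial_free (@gamma R).
Proof. by rewrite unlock; apply: partial_free_var. Qed.

Lemma partialE : partial = 'X%:MP :> scalars R.
Proof. by rewrite unlock. Qed.

Lemma lmodule_torsion_free (L : lmodType {poly R[i]}) (x : L) :
  x *+ 2 = 0 -> x = 0.
Proof.
move=> x2; have two : (2^-1 : R[i])%:P * 2%:R = 1.
  by rewrite mulr_natr -polyCMn -[_^-1 *+ 2]mulr_natr mulVf // Num.Theory.pnatr_eq0.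
by rewrite -[x]scale1r -two -scalerA scaler_nat x2 scaler0.
Qed.

Lemma complex_conformal (L : lmodType {poly R[i]}) (f : L -> L -> {malg L[nat]}) :
  conformal f -> conformal_product lambda f.
Proof.
move=> [[fDl fDr fZl fZr] fdl fdr]; split; first by split.
  by rewrite cprod.unlock; apply: fdl.
by rewrite cprod.unlock -partialE; apply: fdr.
Qed.

Lemma tpca_transposed_poisson (L : tpcaType R) :
  transposed_poisson lambda mu (@circ R L) (@lie R L).
Proof.
have [circ_conf circA circC] := @circ_comm_assoc R L.
have [lie_conf lieN lieJ] := @lie_is_lie R L.
split; try exact: complex_conformal.
- by move=> a b; rewrite expr0 scale1r cprod.unlock -partialE; apply: circC.
- move=> a b; rewrite expr1 scaleN1r cprod.unlock -partialE [- partial - _]addrC.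
  exact: lieN.
- by rewrite cprod.unlock; apply: circA.
- by rewrite cprod.unlock; apply: lieJ.
- by rewrite cprod.unlock; apply: transposed_leibniz.
Qed.

End ComplexCoefficients.

Theorem theorem3p5 (R : realType) (L : tpcaType R) (x y z h u v : L) :
  [/\ x \circ_(lambda) \[y, z\]_(mu)
        + y \circ_(mu) \[z, x\]_(- partial - lambda)
        + z \circ_(- partial - lambda - mu) \[x, y\]_(lambda) = 0,
      \[x, y\]_(lambda) \circ_(mu) z
        + \[y, z\]_(mu - lambda) \circ_(- partial - lambda) x
        + \[z, x\]_(- partial - lambda) \circ_(- partial - mu + lambda) y = 0,
      \[h \circ_(lambda) \[x, y\]_(gamma), z\]_(lambda + mu)
        + \[h \circ_(lambda) \[y, z\]_(mu - gamma), x\]_(- partial - gamma)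
        + \[h \circ_(lambda) \[z, x\]_(- partial - gamma), y\]_(- partial - mu + gamma)
        = 0,
      \[\[x, y\]_(gamma), h \circ_(lambda) z\]_(mu)
        + \[\[y, z\]_(mu - gamma), h \circ_(lambda) x\]_(- partial - lambda - gamma)
        + \[\[z, x\]_(- partial - gamma), h \circ_(lambda) y\]_(- partial - lambda - mu + gamma)
        = 0 &
      [/\ \[h, x\]_(lambda) \circ_(lambda + gamma) \[y, z\]_(mu - gamma)
            + \[h, y\]_(lambda) \circ_(lambda + mu - gamma) \[z, x\]_(- partial - gamma)
            + \[h, z\]_(lambda) \circ_(- partial - mu) \[x, y\]_(gamma) = 0,
          \[u \circ_(lambda) x, v \circ_(gamma) y\]_(mu)
            + \[v \circ_(gamma) x, u \circ_(lambda) y\]_(gamma + mu - lambda)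
            = ((u \circ_(lambda) v) \circ_(lambda + gamma) \[x, y\]_(mu - lambda)) *+ 2 &
          x \circ_(mu - lambda) \[u, v \circ_(gamma) y\]_(lambda)
            + \[v \circ_(gamma) x, u\]_(gamma + mu - lambda) \circ_(gamma + mu) y
            = (u \circ_(lambda) v) \circ_(lambda + gamma) \[x, y\]_(mu - lambda)]].
Proof.
have rules := conformal_rules (@evs_lambda R) (@evs_mu R)
  (@partial_free_lambda R) (@partial_free_mu R)
  (@tpca_transposed_poisson R L) (@lmodule_torsion_free R L).
rewrite -partialE in rules.
have l_free := @partial_free_lambda R; have m_free := @partial_free_mu R.
have g_free := @partial_free_gamma R.
have := symmetrised_identities rules l_free m_free g_free
  (partial_freeB m_free l_free) (partial_freeB m_free g_free)
  (x : formal L) (y : formal L) (z : formal L) (h : formal L) (u : formal L)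
  (v : formal L).
by rewrite cprod.unlock.
Qed.
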